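(* Let $\ell>0$, let $\Delta\ge 0$ and $h>0$ be chosen independently, let $r:U\to U$ be a flux and let $r^h:U\to U$ be a grid-compatible numerical flux. Let $u$ satisfy the conservation law $\partial_t u+\partial_x r(u)=0$, with $u(\cdot,t)\in U$ for each $t$. Let $\bar u^{\Delta,h}:=f^h f^\Delta u$. Then $\bar u^{\Delta,h}$ satisfies, at every point $x$ and every time $t$, $$\partial_t \bar u^{\Delta,h}+\partial^h_x\, r^h\big(\bar u^{\Delta,h}\big)=-\,\partial^h_x\,\tau^{\Delta,h}(u),\qquad\text{where}\qquad \tau^{\Delta,h}(u):=f^\Delta\big(r(u)\big)-r^h\big(\bar u^{\Delta,h}\big).$$
   Context: $U$ is the space of $\ell$-periodic functions $\mathbb{R}\to\mathbb{R}$, taken sufficiently regular (e.g. smooth) so that all derivatives and integrals exist; the solution $u(x,t)$ is likewise sufficiently regular in $(x,t)$ to differentiate in $t$ under the integral sign. The flux $r:U\to U$ is a possibly nonlinear spatial operator (for instance $r(u)=\tfrac12u^2-\nu\partial_xu$). Operators act on the spatial variable at each fixed time. LES filter: $f^\Delta:U\to U$ is the convolution $(f^\Delta u)(x)=\int_{\mathbb{R}}G^\Delta(x-y)u(y)\,\mathrm{d}y$ with an integrable kernel $G^\Delta:\mathbb{R}\to\mathbb{R}$; for $\Delta=0$, $f^\Delta$ is the identity. Finite-volume grid filter: $(f^hu)(x)=\frac1h\int_{x-h/2}^{x+h/2}u(y)\,\mathrm{d}y$. Finite difference: $\partial^h_xu(x)=\frac1h\left[u(x+\tfrac h2)-u(x-\tfrac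 h2)\right]$. A numerical flux $r^h:U\to U$ is called grid-compatible if, for all $x$, $r^h(u)(x)$ depends only on the values $\{u(x+ih+h/2): i\in\mathbb{Z}\}$. *)

(* Defs.v *)
From HB Require Import structures.
From mathcomp Require Import all_boot all_order all_algebra.
From mathcomp Require Import all_classical all_reals all_analysis.
From mathcomp Require Import measurable_realfun lra.

Set Implicit Arguments.
Unset Strict Implicit.
Unset Printing Implicit Defensive.
Import Order.TTheory GRing.Theory Num.Theory.
Import numFieldNormedType.Exports.
Local Open Scope ring_scope.
Local Open Scope classical_set_scope.

Definition smooth (R : realType) (f : R -> R) : Prop :=
  forall (n : nat) (x : R), derivable f^`(n) x 1.

(* The space U of smooth l-periodic functions. *)
Record periodic_space (R : realType) (l : {posnum R}) := PeriodicSpace {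
  periodic_fun :> R -> R;
  periodic_fun_periodic : periodic periodic_fun l%:num;
  periodic_fun_smooth : smooth periodic_fun }.
Arguments periodic_fun_periodic {R l} p : rename.
Arguments periodic_fun_smooth {R l} p : rename.

(* A family of LES kernels G^D, indexed by the filter width D; there is no
   condition on the kernel at D = 0, where the filter is the identity. *)
Record les_kernel (R : realType) := LesKernel {
  les_kernel_fun :> R -> R -> R;
  les_kernel_integrable : forall D : R, 0 < D ->
    lebesgue_measure.-integrable [set: R] (EFin \o les_kernel_fun D) }.

Definition convolution (R : realType) (G f : R -> R) (x : R) : R :=
  \int[lebesgue_measure]_(y in [set: R]) (G (x - y) * f y).

Definition les_filter_fun (R : realType) (G : les_kernel R) (D : R)
    (f : R -> R) : R -> R :=
  if D == 0 then f else convolution (G D) f.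

Definition grid_filter_fun (R : realType) (h : R) (f : R -> R) (x : R) : R :=
  h^-1 * \int[lebesgue_measure]_(y in `[x - h / 2, x + h / 2]) f y.

Section well_defined.
Context {R : realType} {l : {posnum R}}.
Local Notation mu := (@lebesgue_measure R).
Implicit Types (G : R -> R) (D h : R) (f : periodic_space l).

Let TR : measurableType _ := measurableTypeR R.

Let refl (x : R) : TR -> TR := fun y => x - y.

Lemma measurable_reflect (x : R) : measurable_fun [set: TR] (refl x).
Proof. by apply: measurable_funB; [exact: measurable_cst|exact: measurable_id]. Qed.

Lemma lebesgue_measure_reflect (x : R) (A : set TR) : measurable A ->
  pushforward mu (refl x) A = mu A.
Proof.
move=> mA; apply/esym/lebesgue_measure_unique => //=.
  exact: measurable_reflect.
move=> mx _ [[a b]] _ <-.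
rewrite /pushforward/=.
have -> : refl x @^-1` `]a, b] = `[x - b, x - a[.
  apply/seteqP; split => y /=; rewrite !in_itv/=.
    by move=> /andP[h1 h2]; rewrite lerBlDl -lerBlDr h2 ltrBrDl -ltrBrDr h1.
  by rewrite lerBlDl -lerBlDr ltrBrDl -ltrBrDr => /andP[-> ->].
rewrite !lebesgue_measure_itv/= !lte_fin.
rewrite ltrD2l ltrN2; congr (if _ then _ else _).
by rewrite -!EFinB; congr (_%:E); rewrite [RHS]addrC opprB addrA subrK.
Qed.

Lemma eq_measure_reflect (x : R) (f : R -> R) :
  mu.-integrable [set: R] (EFin \o f) ->
  mu.-integrable [set: R] (EFin \o (fun y => f (x - y))) /\
  \int[mu]_(y in [set: R]) f (x - y) = \int[mu]_(y in [set: R]) f y.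
Proof.
move=> intf.
have mx := measurable_reflect x.
have mf : measurable_fun [set: TR] (EFin \o f).
  exact: measurable_int intf.
have eqm A : measurable A -> A `<=` [set: TR] -> mu A = pushforward mu (refl x) A.
  by move=> mA _; rewrite lebesgue_measure_reflect.
have int1 : mu.-integrable [set: TR] (EFin \o (f : TR -> R) \o refl x).
  apply/integrableP; split; first exact: (measurableT_comp mf mx).
  have /integrableP[_] := intf; apply: le_lt_trans.
  rewrite [leRHS](eq_measure_integral (pushforward mu (refl x)) eqm).
  rewrite (ge0_integral_pushforward mx)//.
  exact: measurableT_comp mf.
split=> //.
rewrite /Rintegral; congr fine.
rewrite [RHS](eq_measure_integral (pushforward mu (refl x)) eqm).
by rewrite (integral_pushforward mx mf).
Qed.

Lemma smooth_continuous (f : R -> R) : smooth f -> continuous f.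
Proof.
move=> sf x; apply/differentiable_continuous/derivable1_diffP.
exact: (sf 0%N).
Qed.

Lemma periodicZ (f : R -> R) (T : R) (k : int) (x : R) : periodic f T ->
  f (x + k%:~R * T) = f x.
Proof.
move=> pf; case: k => n.
  by rewrite -pmulrn mulr_natl periodicn.
rewrite NegzE mulrNz -pmulrn mulNr mulr_natl.
by rewrite -[LHS](periodicn pf n.+1) subrK.
Qed.

Lemma periodic_bounded f : exists M : R, forall x, `|f x| <= M.
Proof.
have cf := smooth_continuous (periodic_fun_smooth f).
have l0 : 0 <= l%:num by [].
have cnf : {within `[0, l%:num], continuous (fun x => `|f x|)}.
  apply: continuous_subspaceT => x; apply: continuous_comp; first exact: cf.
  exact: norm_continuous.
have [c _ cmax] := EVT_max l0 cnf.
exists `|f c| => x.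
pose k := Num.floor (x / l%:num).
have -> : f x = f (x - k%:~R * l%:num).
  by rewrite -mulNr -mulrNz periodicZ//; exact: periodic_fun_periodic.
apply: cmax; rewrite in_itv/= subr_ge0.
rewrite -ler_pdivlMr// floor_le/=.
rewrite lerBlDr -[X in X + _]mul1r -mulrDl addrC -ler_pdivrMr//.
by rewrite -[1]/(1%:~R) -intrD ltW// floorD1_gt.
Qed.

Lemma derive1_periodic (f : R -> R) (T : R) : periodic f T ->
  periodic f^`() T.
Proof.
move=> pf x; rewrite /derive1; congr (lim _).
suff -> : (fun h => h^-1 *: (f (h + (x + T)) - f (x + T))) =
          (fun h => h^-1 *: (f (h + x) - f x)) by [].
by apply/funext => h; rewrite addrA !pf.
Qed.

Lemma smooth_derive1 (f : R -> R) : smooth f -> smooth f^`().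
Proof. by move=> sf n x; rewrite -derive1Sn; exact: sf. Qed.

Definition periodic_derive f : periodic_space l :=
  PeriodicSpace (derive1_periodic (periodic_fun_periodic f))
    (smooth_derive1 (periodic_fun_smooth f)).

Lemma integrable_conv G f (x : R) : mu.-integrable [set: R] (EFin \o G) ->
  mu.-integrable [set: R] (EFin \o (fun y => G y * f (x - y))).
Proof.
move=> intG; have [M fM] := periodic_bounded f.
have -> : EFin \o (fun y => G y * f (x - y)) =
    ((EFin \o G) \* (EFin \o (fun y => f (x - y)%R)))%E.
  by apply/funext => y /=; rewrite EFinM.
apply: integrableMl => //.
  apply: continuous_measurable_fun => y.
  apply: (@continuous_comp _ _ _ (fun y => x - y) f).
    by apply: continuousB => //; exact: cst_continuous.
  exact/smooth_continuous/periodic_fun_smooth.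
exists M; split; first exact: num_real.
by move=> M' MM' y _ /=; apply: le_trans (fM _) (ltW _).
Qed.

Lemma convolutionC G f (x : R) : mu.-integrable [set: R] (EFin \o G) ->
  convolution G f x = \int[mu]_(y in [set: R]) (G y * f (x - y)).
Proof.
move=> intG; have [_ <-] := eq_measure_reflect x (integrable_conv f x intG).
by rewrite /convolution; apply: eq_Rintegral => y _; rewrite subKr.
Qed.

Lemma is_derive_convolution G f (x : R) :
  mu.-integrable [set: R] (EFin \o G) ->
  is_derive x 1 (convolution G f) (convolution G (derive1 f) x).
Proof.
move=> intG; have [M fM] := periodic_bounded (periodic_derive f).
have M0 : 0 <= M by exact: le_trans (fM 0).
have -> : convolution G f = fun x => \int[mu]_(y in [set: R]) (G y * f (x - y)).
  by apply/funext => z; exact: convolutionC.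
rewrite (@convolutionC G (periodic_derive f))//.
pose F (x y : R) : R := G y * f (x - y).
have dF (z y : R) : is_derive z 1 (F ^~ y) (G y * derive1 f (z - y)).
  have df : is_derive (z - y) 1 f (derive1 f (z - y)).
    apply: DeriveDef; last by rewrite derive1E.
    exact: (periodic_fun_smooth f 0%N).
  have := is_deriveZ (G y) (@is_derive1_comp R f (shift (- y)) z _ _ df (is_derive_shift z 1 (- y))).
  by rewrite mulr1.
have E (z y : R) : partial1of2 F z y = G y * derive1 f (z - y).
  by rewrite /partial1of2 derive1E; exact: derive_val.
have xI : `]x - 1, x + 1[%classic x.
  by rewrite /= in_itv/= ltrBlDr ltrDl ltr01.
have intF z : `]x - 1, x + 1[%classic z -> mu.-integrable [set: R] (EFin \o F z).
  by move=> _; exact: integrable_conv.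
have derF z y : `]x - 1, x + 1[%classic z -> [set: R] y -> derivable (F ^~ y) z 1.
  by move=> _ _; exact: ex_derive.
have G0 y : 0 <= `|G y| * M by rewrite mulr_ge0.
have intGM : mu.-integrable [set: R] (EFin \o (fun y => `|G y| * M)).
  have -> : EFin \o (fun y => `|G y| * M) =
      ((abse \o (EFin \o G)) \* (EFin \o cst M))%E.
    by apply/funext => y /=; rewrite EFinM.
  apply: integrableMl => //; first exact: integrable_abse.
  exact: bounded_cst.
have ub z y : `]x - 1, x + 1[%classic z -> [set: R] y ->
    `|partial1of2 F z y| <= `|G y| * M.
  by move=> _ _; rewrite E normrM ler_wpM2l//; exact: fM.
apply: DeriveDef.
  exact: (derivable_under_integral measurableT xI intF derF G0 intGM ub).
rewrite -derive1E.
rewrite (differentiation_under_integral measurableT xI intF derF G0 intGM ub).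
by apply: eq_Rintegral => y _; rewrite E.
Qed.


Lemma derive1n_convolution G f (n : nat) :
  mu.-integrable [set: R] (EFin \o G) ->
  derive1n n (convolution G f) = convolution G (iter n periodic_derive f).
Proof.
move=> intG; elim: n => [//|n IHn]; rewrite derive1nS IHn; apply/funext => x.
by rewrite derive1E (@derive_val _ _ _ _ _ _ _ (is_derive_convolution _ x intG)).
Qed.

Lemma smooth_convolution G f : mu.-integrable [set: R] (EFin \o G) ->
  smooth (convolution G f).
Proof.
move=> intG n x; rewrite derive1n_convolution//.
by have [] := is_derive_convolution (iter n periodic_derive f) x intG.
Qed.

Lemma periodic_convolution G f : mu.-integrable [set: R] (EFin \o G) ->
  periodic (convolution G f) l%:num.
Proof.
move=> intG x; rewrite !convolutionC//; apply: eq_Rintegral => y _.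
by rewrite addrAC periodic_fun_periodic.
Qed.

Lemma les_filter_periodic (G : les_kernel R) D f : 0 <= D ->
  periodic (les_filter_fun G D f) l%:num.
Proof.
rewrite /les_filter_fun; case: eqVneq => [_ _|D0 D_ge0].
  exact: periodic_fun_periodic.
by apply/periodic_convolution/les_kernel_integrable; rewrite lt_def D0.
Qed.

Lemma les_filter_smooth (G : les_kernel R) D f : 0 <= D ->
  smooth (les_filter_fun G D f).
Proof.
rewrite /les_filter_fun; case: eqVneq => [_ _|D0 D_ge0].
  exact: periodic_fun_smooth.
by apply/smooth_convolution/les_kernel_integrable; rewrite lt_def D0.
Qed.

Let box (h : R) : R -> R := \1_(`[- (h / 2), h / 2]).

Lemma integrable_box (h : R) : mu.-integrable [set: R] (EFin \o box h).
Proof.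
exact: (@integrable_indic_itv R (- (h / 2)) (h / 2) true false).
Qed.

Lemma integrable_top_hat (h : R) :
  mu.-integrable [set: R] (EFin \o (fun y => h^-1 * box h y)).
Proof.
have -> : EFin \o (fun y => h^-1 * box h y) =
    (fun y => h^-1%:E * (EFin \o box h) y)%E.
  by apply/funext => y /=; rewrite EFinM.
exact/integrableZl/integrable_box.
Qed.

Lemma grid_filterE (h : R) f :
  grid_filter_fun h f = convolution (fun y => h^-1 * box h y) f.
Proof.
apply/funext => x; rewrite /grid_filter_fun /convolution.
have [int _] := eq_measure_reflect x (integrable_conv f x (integrable_box h)).
transitivity (\int[mu]_(y in [set: R]) (h^-1 * (box h (x - y) * f (x - (x - y))))).
  rewrite RintegralZl//; congr (_ * _).
  rewrite Rintegral_mkcond; apply: eq_Rintegral => y _.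
  rewrite /box indicE patchE subKr.
  have -> : (x - y \in `[- (h / 2), h / 2]%classic) =
            (y \in `[x - h / 2, x + h / 2]%classic).
    apply/idP/idP; rewrite !inE/= !in_itv/= => /andP[h1 h2]; apply/andP; lra.
  by case: ifP => _; rewrite ?mul1r ?mul0r.
by apply: eq_Rintegral => y _; rewrite subKr mulrA.
Qed.

Lemma grid_filter_periodic (h : R) f : periodic (grid_filter_fun h f) l%:num.
Proof. by rewrite grid_filterE; exact/periodic_convolution/integrable_top_hat. Qed.

Lemma grid_filter_smooth (h : R) f : smooth (grid_filter_fun h f).
Proof. by rewrite grid_filterE; exact/smooth_convolution/integrable_top_hat. Qed.

(* f^D : U -> U *)
Definition les_filter (G : les_kernel R) D (D_ge0 : 0 <= D) f : periodic_space l :=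
  PeriodicSpace (@les_filter_periodic G D f D_ge0) (@les_filter_smooth G D f D_ge0).

(* f^h : U -> U; f^h is the convolution with the kernel 1_[-h/2, h/2] / h, which
   is how membership in U is established. *)
Definition grid_filter h f : periodic_space l :=
  PeriodicSpace (@grid_filter_periodic h f) (@grid_filter_smooth h f).

End well_defined.

Section finite_volume.
Context {R : realType} {l : {posnum R}}.
Implicit Types (D h x t : R).
Local Notation U := (periodic_space l).

Definition finite_difference h (v : R -> R) x : R :=
  (v (x + h / 2) - v (x - h / 2)) / h.

Definition grid_compatible h (rh : U -> U) : Prop :=
  forall (v w : U) x,
    (forall i : int, v (x + i%:~R * h + h / 2) = w (x + i%:~R * h + h / 2)) ->
    rh v x = rh w x.

(* Time derivative of a time-dependent field; u t is the field at time t. *)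
Definition time_derivative (u : R -> U) t x : R := derive1 (fun s => u s x) t.

(* Enough to differentiate in time under a spatial integral: smoothness in x is
   already part of U, and periodicity in x turns joint continuity of the time
   derivative into a bound uniform in x and locally uniform in t. *)
Definition time_regular (J : set R) (u : R -> U) : Prop :=
  forall t x, J t ->
    derivable (fun s => u s x) t 1 /\
    {for (t, x), continuous (fun p : R * R => time_derivative u p.1 p.2)}.

Definition conservation_law (J : set R) (r : U -> U) (u : R -> U) : Prop :=
  forall t x, J t -> time_derivative u t x + derive1 (r (u t)) x = 0.

Definition filtered (G : les_kernel R) D (D_ge0 : 0 <= D) h (u : U) : U :=
  grid_filter h (les_filter G D_ge0 u).

(* tau^{D,h}(u) *)
Definition subfilter_flux (G : les_kernel R) D (D_ge0 : 0 <= D) h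
    (r rh : U -> U) (u : U) (x : R) : R :=
  les_filter G D_ge0 (r u) x - rh (filtered G D_ge0 h u) x.

End finite_volume.

(* Main.v *)
Require Import Defs.
From HB Require Import structures.
From mathcomp Require Import all_boot all_order all_algebra.
From mathcomp Require Import all_classical all_reals all_analysis.
From mathcomp Require Import lra.
Set Implicit Arguments.
Unset Strict Implicit.
Unset Printing Implicit Defensive.
Import Order.TTheory GRing.Theory Num.Theory.
Import numFieldNormedType.Exports.
Local Open Scope ring_scope.
Local Open Scope classical_set_scope.

(** Both filters are convolutions with an integrable kernel (for the LES filter
of width 0, the identity), and a convolution commutes with d/dx and, when the
differentiation under the integral sign is justified, with d/dt. Filtering
[d_t u + d_x r(u) = 0] twice therefore gives
[d_t ubar + d_x (f^h (f^D (r u))) = 0]. By the fundamental theorem of calculus,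
[d_x f^h] is the finite difference of step [h] ([derive1_grid_filter]), so
[d_t ubar = - finite_difference h (f^D (r u))] holds exactly. Adding the finite
difference of the numerical flux of ubar to both sides gives the statement,
because finite differences are linear.

The analytic content is the exchange of d/dt with the two integrals, for which
a bound on the time derivative, locally uniform in time and uniform over the
whole line, suffices. This bound is part of the invariant
[dominated_law]. It holds for [u] because the time derivative is jointly
continuous and periodic in space, so that compactness of one period applies
([dominated_law_regular]), and it passes to the convolution with any integrable
kernel, with the bound multiplied by the L1 norm of the kernel
([dominated_law_convolution]), so that it is available again for the second
filter. *)

Section filtered_conservation_law.
Context {R : realType} {l : {posnum R}}.
Local Notation mu := (@lebesgue_measure R).
Local Notation U := (periodic_space l).
Implicit Types (G : R -> R) (f : U) (a b h M s t x : R).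

Lemma smooth_continuous_derive1 (f : R -> R) : smooth f -> continuous f^`().
Proof. by move/smooth_derive1; exact: smooth_continuous. Qed.

Lemma mod_period x : exists2 y, 0 <= y <= l%:num &
  forall f : R -> R, periodic f l%:num -> f y = f x.
Proof.
pose k := Num.floor (x / l%:num).
exists (x - k%:~R * l%:num).
  rewrite subr_ge0 -ler_pdivlMr// floor_le/=.
  rewrite lerBlDr -[X in X + _]mul1r -mulrDl addrC -ler_pdivrMr//.
  by rewrite -[1]/(1%:~R) -intrD ltW// floorD1_gt.
by move=> f pf; rewrite -mulNr -mulrNz periodicZ.
Qed.

(** The field [v] obeys the conservation law with flux field [q] near time [t],
with a bound on its time derivative that does not depend on the position: this
is what dominated convergence under a spatial integral consumes. It concerns
plain functions so that it applies to unfolded filters and to fields in U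
alike. *)
Definition dominated_law (v q : R -> R -> R) M t : Prop :=
  \forall s \near t, forall x,
    is_derive (s : R) 1 (v ^~ x) (- derive1 (q s) x) /\ `|derive1 (q s) x| <= M.

Lemma dominated_law_point (v q : R -> R -> R) M t x : dominated_law v q M t ->
  is_derive t 1 (v ^~ x) (- derive1 (q t) x).
Proof. by move/nbhs_singleton => /(_ x)[]. Qed.
Arguments dominated_law_point {v q M t} x.

Lemma derive1_convolution G f x : mu.-integrable [set: R] (EFin \o G) ->
  derive1 (convolution G f) x = convolution G (derive1 f) x.
Proof.
by move=> intG; rewrite derive1E; have [] := is_derive_convolution f x intG.
Qed.

Lemma integrable_normM G M : mu.-integrable [set: R] (EFin \o G) ->
  mu.-integrable [set: R] (EFin \o (fun y => `|G y| * M)).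
Proof.
move=> intG.
have -> : EFin \o (fun y => `|G y| * M) =
    (fun y => M%:E * (EFin \o (Num.norm \o G)) y)%E.
  by apply/funext => y /=; rewrite -EFinM mulrC.
exact/integrableZl/integrable_norm.
Qed.

(** Young's inequality for the exponents 1 and infinity. *)
Lemma convolution_bound G f M x : mu.-integrable [set: R] (EFin \o G) ->
  (forall y, `|f y| <= M) ->
  `|convolution G f x| <= (\int[mu]_(y in [set: R]) `|G y|) * M.
Proof.
move=> intG fM; rewrite convolutionC//.
have intGf := integrable_conv f x intG.
have intnG := integrable_norm intG.
apply: (le_trans (le_normr_Rintegral _ intGf)) => //.
rewrite -RintegralZr//; apply: le_Rintegral => //.
- exact: integrable_norm intGf.
- exact: integrable_normM.
- by move=> y _ /=; rewrite normrM ler_wpM2l.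
Qed.

(** Once the convolution is rewritten with the shift on the field rather than
on the kernel, the time derivative of the integrand is dominated by
[|G y| * M], which is integrable. *)
Lemma is_derive_convolution_param G (v : R -> U) (w : R -> R -> R) M a b t x :
  mu.-integrable [set: R] (EFin \o G) ->
  (forall s y, a < s < b ->
    is_derive s 1 (fun s => v s y) (w s y) /\ `|w s y| <= M) ->
  a < t < b ->
  is_derive t 1 (fun s => convolution G (v s) x)
    (\int[mu]_(y in [set: R]) (G y * w t (x - y))).
Proof.
move=> intG vw tab.
pose F (s y : R) : R := G y * v s (x - y).
have -> : (fun s => convolution G (v s) x) =
    (fun s => \int[mu]_(y in [set: R]) F s y).
  by apply/funext => s; exact: convolutionC.
have dF s y : a < s < b -> is_derive s 1 (F ^~ y) (G y * w s (x - y)).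
  by move=> /(vw _ (x - y))[dv _]; exact: is_deriveZ.
have E s y : a < s < b -> partial1of2 F s y = G y * w s (x - y).
  by move=> sab; rewrite /partial1of2 derive1E; have [] := dF s y sab.
have M0 : 0 <= M by have [_] := vw _ 0 tab; exact: le_trans.
have tI : `]a, b[%classic t by rewrite /= in_itv.
have intF s : `]a, b[%classic s -> mu.-integrable [set: R] (EFin \o F s).
  by move=> _; exact: integrable_conv.
have derF s y : `]a, b[%classic s -> [set: R] y -> derivable (F ^~ y) s 1.
  by rewrite /= in_itv/= => sab _; have [] := dF s y sab.
have G0 y : 0 <= `|G y| * M by rewrite mulr_ge0.
have intGM := integrable_normM M intG.
have ub s y : `]a, b[%classic s -> [set: R] y ->
    `|partial1of2 F s y| <= `|G y| * M.
  rewrite /= in_itv/= => sab _; rewrite E// normrM ler_wpM2l//.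
  by have [] := vw _ (x - y) sab.
apply: DeriveDef.
  exact: (derivable_under_integral measurableT tI intF derF G0 intGM ub).
rewrite -derive1E.
rewrite (differentiation_under_integral measurableT tI intF derF G0 intGM ub).
by apply: eq_Rintegral => y _; rewrite E.
Qed.

(** The bound passes to the filtered field because its time derivative is, up to
sign, the convolution of [G] with [derive1 (q s)]. The law is needed on a
whole ball around [t]: each time in the ball is differentiated inside it. *)
Lemma dominated_law_convolution G (v q : R -> U) M t :
  mu.-integrable [set: R] (EFin \o G) ->
  dominated_law v q M t ->
  dominated_law (fun s => convolution G (v s)) (fun s => convolution G (q s))
    ((\int[mu]_(y in [set: R]) `|G y|) * M) t.
Proof.
move=> intG /nbhs_ballP[e /= e0 vq].
apply/nbhs_ballP; exists e => //= s ts x.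
split; last first.
  rewrite derive1_convolution//.
  apply: (@convolution_bound G (periodic_derive (q s))) => // y.
  by have [] := vq s ts y.
rewrite derive1_convolution// -mulN1r.
rewrite (@convolutionC _ _ _ (periodic_derive (q s)))// -RintegralZl//; last first.
  exact: (integrable_conv (periodic_derive (q s))).
under eq_Rintegral do rewrite mulN1r -mulrN.
apply: (@is_derive_convolution_param _ _
  (fun s y => - derive1 (q s) y) M (t - e) (t + e)) => //.
  move=> s' y s'te; rewrite normrN; apply: vq.
  by rewrite ball_itv/= in_itv.
by move: ts; rewrite ball_itv/= in_itv.
Qed.

Lemma dominated_law_les_filter (K : les_kernel R) D (D_ge0 : 0 <= D)
    (v q : R -> U) M t : dominated_law v q M t ->
  exists M', dominated_law (fun s => les_filter K D_ge0 (v s))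
    (fun s => les_filter K D_ge0 (q s)) M' t.
Proof.
move=> vq; rewrite /= /les_filter_fun; case: eqVneq => [_|D0]; first by exists M.
eexists; apply: dominated_law_convolution vq.
by apply: les_kernel_integrable; rewrite lt_def D0.
Qed.

(** Differentiating the moving average leaves the average of the derivative,
which the fundamental theorem of calculus integrates. *)
Lemma derive1_grid_filter h f x : 0 < h ->
  derive1 (grid_filter h f) x = finite_difference h f x.
Proof.
move=> h0.
have -> : derive1 (grid_filter h f) x = grid_filter_fun h (derive1 f) x.
  rewrite (grid_filterE h (periodic_derive f)) /= grid_filterE.
  by rewrite derive1_convolution//; exact: integrable_top_hat.
rewrite /grid_filter_fun /finite_difference mulrC; congr (_ / _).
have ab : x - h / 2 < x + h / 2 by lra.
have sf := periodic_fun_smooth f.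
rewrite /Rintegral (@continuous_FTC2 _ _ f)//.
- exact/continuous_subspaceT/smooth_continuous_derive1.
- have cf := smooth_continuous sf; split.
  + by move=> y _; exact: (sf 0%N).
  + exact/cvg_at_right_filter/cf.
  + exact/cvg_at_left_filter/cf.
Qed.

(** The flux gradient at time [t] is bounded by some [M]; by joint continuity,
the time derivative is at most [M + 1] in absolute value near every point of [{t} * [0, l]],
hence, by compactness of [[0, l]], on a strip of times common to all positions.
Periodicity extends the bound to the line. *)
Lemma dominated_law_regular (J : set R) (r : U -> U) (u : R -> U) t :
  open J -> time_regular J u -> conservation_law J r u -> J t ->
  exists M, dominated_law u (fun s => r (u s)) M t.
Proof.
move=> oJ ureg ulaw Jt.
have law s x : J s -> time_derivative u s x = - derive1 (r (u s)) x.
  by move=> Js; apply/eqP; rewrite -addr_eq0 ulaw.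
have [M tM] := periodic_bounded (periodic_derive (r (u t))).
exists (M + 1).
have bound : \forall s \near t,
    `[0, l%:num] `<=` [set x | `|time_derivative u s x| <= M + 1].
  have /compact_near_coveringP cover := @segment_compact R 0 l%:num.
  apply: (cover R (nbhs t) (fun s x => `|time_derivative u s x| <= M + 1)
    (nbhs_filter t)) => x _.
  have [_ ct] := ureg t x Jt.
  have : \forall p \near (t, x), `|time_derivative u p.1 p.2| <= M + 1.
    apply: (cvgr_norm_le _ ct); rewrite /= law// normrN.
    by apply: le_lt_trans (tM x) _; rewrite ltrDl.
  case=> -[A B] /= [tA xB] AB; exists (B, A) => // -[y s] [By As].
  exact: (AB (s, y)).
near=> s.
have Js : J s by near: s; exact: open_nbhs_nbhs.
move=> x; split.
  have [du _] := ureg s x Js.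
  by apply: DeriveDef => //; rewrite -law// /time_derivative derive1E.
have [y y0l yx] := mod_period x.
rewrite -yx; last exact/derive1_periodic/periodic_fun_periodic.
rewrite -normrN -law//.
by apply: (near bound s).
Unshelve. all: end_near. Qed.

End filtered_conservation_law.

Theorem mainTheorem1 (R : realType) (l : {posnum R})
  (D : R) (D_ge0 : 0 <= D) (h : R) (h_gt0 : 0 < h) (G : les_kernel R)
  (r rh : periodic_space l -> periodic_space l)
  (rh_grid : grid_compatible h rh)
  (J : set R) (J_open : open J) (u : R -> periodic_space l)
  (u_regular : time_regular J u)
  (u_law : conservation_law J r u) :
  let ubar := fun t => filtered G D_ge0 h (u t) in
  forall x t, J t ->
    derivable (fun s => ubar s x) t 1 /\
    time_derivative ubar t x + finite_difference h (rh (ubar t)) x =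
      - finite_difference h (subfilter_flux G D_ge0 h r rh (u t)) x.
Proof.
move=> ubar x t Jt.
have [M law_u] := dominated_law_regular J_open u_regular u_law Jt.
have [M' law_les] := dominated_law_les_filter G D_ge0 law_u.
have /(dominated_law_point x) :=
  dominated_law_convolution (integrable_top_hat h) law_les.
under eq_fun do rewrite -grid_filterE.
rewrite -grid_filterE derive1_grid_filter// => -[dubar ubarE].
split=> //; rewrite /time_derivative derive1E ubarE.
rewrite /finite_difference /subfilter_flux -/(ubar t).
lra.
Qed.
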